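(* Let $U$ be a connected graph on $n>2$ vertices that has exactly one cycle, this cycle has $3$ vertices, and $U$ is obtained from the triangle by attaching a (possibly trivial) tree at one vertex of the triangle (so at most one vertex of the triangle has degree greater than $2$ in $U$). Let $\Delta$ be the distance squared matrix of $U$ and let $\ell$ be the number of leaves (vertices of degree $1$) of $U$. Then $i_-(\Delta)=\ell+2$.
   Context: For a connected graph $G$ with vertices $1,\dots,n$, the distance squared matrix $\Delta$ is the $n\times n$ matrix with $(i,j)$ entry $d_{ij}^2$, where $d_{ij}$ is the graph distance between $i$ and $j$. For a real symmetric matrix $M$, $i_-(M)$ denotes the number of negative eigenvalues of $M$ counted with multiplicity. *)

(* Defs.v *)
From HB Require Import structures.
From mathcomp Require Import all_boot all_order all_algebra.
From mathcomp Require Import polyrcf.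
Set Implicit Arguments. Unset Strict Implicit. Unset Printing Implicit Defensive.
Import Order.TTheory GRing.Theory Num.Theory.

Definition simple_graph (n : nat) (e : rel 'I_n) : Prop :=
  symmetric e /\ irreflexive e.

Definition connected_graph (n : nat) (e : rel 'I_n) : Prop :=
  forall x y : 'I_n, connect e x y.

Definition deg (n : nat) (e : rel 'I_n) (x : 'I_n) : nat := #|[set y | e x y]|.

Definition nleaves (n : nat) (e : rel 'I_n) : nat := #|[set x | deg e x == 1%N]|.

Definition is_cycle (n : nat) (e : rel 'I_n) (s : seq 'I_n) : bool :=
  (3 <= size s)%N && uniq s && cycle e s.

Definition walk_of_len (n : nat) (e : rel 'I_n) (k : nat) (x y : 'I_n) : bool :=
  [exists p : k.-tuple 'I_n, path e x p && (last x p == y)].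

(* Graph distance: least k such that there is a walk of length k from x to y
   (for a connected graph on n vertices this is < n). *)
Definition gdist (n : nat) (e : rel 'I_n) (x y : 'I_n) : nat :=
  find (fun k => walk_of_len e k x y) (iota 0 n).

Definition dist_sq_mx (R : nzRingType) (n : nat) (e : rel 'I_n) : 'M[R]_n :=
  \matrix_(i, j) (((gdist e i j) ^ 2)%:R)%R.

(* i_-(M): number of negative eigenvalues counted with (algebraic)
   multiplicity = sum over the distinct negative real roots x of the
   characteristic polynomial of the multiplicity of x as a root. *)
Definition neg_inertia (R : rcfType) (n : nat) (M : 'M[R]_n) : nat :=
  (\sum_(x <- rootsR (char_poly M) | (x < 0)%R) mup x (char_poly M))%N.

(* Main.v *)
(* Let a, b be the two vertices of the triangle of degree 2, c the third one, and
   T the tree U - b on n' vertices, with Laplacian L, distance d and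
   tau v = 2 - deg_T v. As a and b are twins, e_a - e_b splits off one negative
   direction, and what is left is the squared distance form of T plus x_a^2 / 2.
   On a tree the identities
     L d(.,j) = tau - 2 [. = j],   L d(.,j)^2 = 2 tau d(.,j) - deg,
     L d(.,j)^3 = 3 d(.,j)^2 tau - 3 deg d(.,j) + tau - 2 [. = j]
   show that in the coordinates (u, s) with x = L (u + s (d(.,a) + 1/2)) + 2 s e_a
   the form of U becomes
     2 s^2 - 4 sum_v (tau v u_v^2 + 2 s u_v + s^2) + (u_a - u_c + s)^2 / 2.
   It is negative definite where only s, u_a and the u_v with v a leaf of U may be
   nonzero, and, if deg c > 2, nonnegative on the complementary coordinates. If
   deg c = 2 then n = 3 and the all-ones vector gives the upper bound. *)
Require Import Defs.
From HB Require Import structures.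
From mathcomp Require Import all_boot all_order all_algebra.
From mathcomp Require Import polyrcf complex ring lra zify.
Import Order.TTheory GRing.Theory Num.Theory.
Set Implicit Arguments. Unset Strict Implicit. Unset Printing Implicit Defensive.

(** * Bounding the negative inertia by coordinate subspaces *)

Section Inertia.
Local Open Scope ring_scope.
Local Open Scope sesquilinear_scope.
Variable R : rcfType.
Local Notation toC := (real_complex R).
Local Notation C := R[i].

Let conj_toC x : Num.conj (toC x) = toC x. Proof. exact: conjc_real. Qed.

Lemma neg_inertia_prod n (M : 'M[R]_n) (lam : 'I_n -> R) :
  char_poly M = \prod_i ('X - (lam i)%:P) ->
  neg_inertia M = #|[set i | lam i < 0]|.
Proof.
move=> Mlam; rewrite /neg_inertia.
have -> : char_poly M = \prod_(y <- [seq lam i | i <- enum 'I_n]) ('X - y%:P).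
  by rewrite Mlam big_map big_enum.
set s := [seq _ | _ <- _].
under eq_bigr do rewrite mu_prod_XsubC.
have mem_roots x : (x \in rootsR (\prod_(y <- s) ('X - y%:P))) = (x \in s).
  have q0 : \prod_(y <- s) ('X - y%:P) != 0 by rewrite monic_neq0 // monic_prod_XsubC.
  by have := roots_on_rootsR q0 x; rewrite inE /= root_prod_XsubC => ->.
have u_roots : uniq (rootsR (\prod_(y <- s) ('X - y%:P))) by rewrite uniq_roots.
have -> : (\sum_(x <- rootsR (\prod_(y <- s) ('X - y%:P)) | (x < 0)%R) count_mem x s)%N
    = (\sum_(x <- undup s | (x < 0)%R) count_mem x s)%N.
  apply: perm_big; apply: uniq_perm; rewrite ?undup_uniq // => x.
  by rewrite mem_undup mem_roots.
transitivity (\sum_(y <- s | (y < 0)%R) 1)%N.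
  rewrite -(big_undup_iterop_count _ s); apply: eq_bigr => x _.
  by rewrite Monoid.iteropE iter_addn_0 mul1n.
by rewrite big_map big_enum_cond /= sum1_card cardsE.
Qed.

(** Over [R[i]] the matrix is Hermitian, so it is diagonalised by a unitary matrix with real
    eigenvalues. The factorisation of the characteristic polynomial then descends to [R], because
    the embedding of polynomials is injective. *)
Lemma sym_spectral n (M : 'M[R]_n) : M^T = M ->
  exists U : 'M[C]_n, exists lam : 'I_n -> R,
    [/\ U \in unitmx,
        map_mx toC M = U^t* *m diag_mx (\row_i toC (lam i)) *m U &
        char_poly M = \prod_i ('X - (lam i)%:P)].
Proof.
move=> symM; pose A := map_mx toC M.
have hermA : A \is hermsymmx.
  apply/is_hermitianmxP; rewrite expr0 scale1r.
  apply/matrixP => i j; have := congr1 (fun B : 'M_n => B i j) symM.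
  by rewrite !mxE => ->; rewrite conj_toC.
have /orthomx_spectralP := hermitian_normalmx hermA.
rewrite invmx_unitary ?spectral_unitarymx //.
set U := spectralmx A => defA.
have /mxOverP re_sp := hermitian_spectral_diag_real hermA.
exists U, (fun i => complex.Re (spectral_diag A 0 i)).
have lamE : \row_i toC (complex.Re (spectral_diag A 0 i)) = spectral_diag A.
  by apply/rowP => i; rewrite mxE RRe_real.
split; rewrite ?lamE ?spectral_unit //.
apply: (map_poly_inj toC); rewrite map_char_poly -/A.
have detA : char_poly A = char_poly (diag_mx (spectral_diag A)).
  have UU : map_mx polyC (U ^t*) *m map_mx polyC U = 1%:M.
    by rewrite -map_mxM -invmx_unitary ?spectral_unitarymx // mulVmx ?spectral_unit // map_mx1.
  have eqA : char_poly_mx A =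
     map_mx polyC (U ^t*) *m char_poly_mx (diag_mx (spectral_diag A)) *m map_mx polyC U.
    rewrite {1}defA /char_poly_mx !map_mxM mulmxBr mulmxBl; congr (_ - _).
    by rewrite scalar_mxC -mulmxA UU mulmx1.
  rewrite /char_poly eqA !det_mulmx mulrAC -[X in X * _]det_mulmx.
  by rewrite UU det1 mul1r.
rewrite detA (char_poly_trig (diag_mx_is_trig _)) rmorph_prod.
apply: eq_bigr => i _; rewrite [RHS]rmorphB /= map_polyX map_polyC mxE eqxx mulr1n.
by congr ('X - _%:P); exact/esym/RRe_real.
Qed.

(** Dimension count: the conditions are fewer than n linear equations, gathered as the columns of
    [K]. *)
Lemma kernel_avoid (F : fieldType) n (B : 'M[F]_n) (S1 S2 : {set 'I_n}) :
  (#|S1| + #|S2| < n)%N ->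
  exists z : 'rV_n, [/\ z != 0, forall i, i \in S1 -> z 0 i = 0 &
                        forall i, i \in S2 -> (z *m B) 0 i = 0].
Proof.
move=> ltn; pose K := row_mx (colsub (enum_val : 'I_#|S1| -> 'I_n) (1%:M : 'M[F]_n))
                             (colsub (enum_val : 'I_#|S2| -> 'I_n) B).
have : kermx K != 0.
  rewrite -mxrank_eq0 mxrank_ker subn_eq0 -ltnNge.
  exact: leq_ltn_trans (rank_leq_col _) ltn.
case/rowV0Pn => z /sub_kermxP; rewrite mul_mx_row -[0]row_mx0.
move=> /eq_row_mx [] z1 z2 z0; exists z; split=> // i iS.
  have /rowP/(_ (enum_rank_in iS i)) := z1.
  by rewrite mulmx_colsub mulmx1 !mxE enum_rankK_in.
have /rowP/(_ (enum_rank_in iS i)) := z2.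
by rewrite mulmx_colsub !mxE enum_rankK_in.
Qed.

Definition qform n (N : 'M[R]_n) (w : 'rV[R]_n) : R := (w *m N *m w^T) 0 0.

(** The mixed terms of the Hermitian form at p + iq cancel by symmetry of [N]. Complex vectors can
    thus be tested through their real and imaginary parts. *)
Lemma complex_qform n (N : 'M[R]_n) (p q : 'rV[R]_n) : N^T = N ->
  let z := map_mx toC p + 'i%C *: map_mx toC q in
  (z *m map_mx toC N *m z^t*) 0 0 = toC (qform N p + qform N q).
Proof.
move=> symN z.
have zt : z^t* = map_mx toC p^T - 'i%C *: map_mx toC q^T.
  apply/matrixP => i j; rewrite !mxE rmorphD rmorphM /=.
  by rewrite !conj_toC -mulNr complexiE conjCi.
have sym : p *m N *m q^T = q *m N *m p^T.
  by rewrite [LHS]mx11_scalar -tr_scalar_mx -mx11_scalar !trmx_mul trmxK symN mulmxA.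
have symC : map_mx toC p *m map_mx toC N *m map_mx toC q^T =
            map_mx toC q *m map_mx toC N *m map_mx toC p^T.
  by rewrite -!map_mxM sym.
rewrite zt mulmxDl mulmxBr !mulmxDl -!scalemxAl -!scalemxAr symC -!map_mxM.
rewrite scalerA -expr2 sqr_i scaleN1r opprD opprK addrA addrK.
by rewrite !mxE /qform rmorphD /= !mxE.
Qed.

Lemma qformM_spectral n (M U : 'M[C]_n) (lam : 'I_n -> R) (z : 'rV[C]_n) :
  M = U^t* *m diag_mx (\row_i toC (lam i)) *m U ->
  (z *m M *m z^t*) 0 0 = \sum_i toC (lam i) * `|(z *m U^t*) 0 i| ^+ 2.
Proof.
move=> ->; set y := z *m U^t*.
have -> : z *m (U^t* *m diag_mx (\row_i toC (lam i)) *m U) *m z^t* =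
          y *m diag_mx (\row_i toC (lam i)) *m y^t*.
  by rewrite /y trmx_mul map_mxM trmxCK !mulmxA.
rewrite mxE; apply: eq_bigr => i _.
by rewrite mul_mx_diag !mxE normCK mulrAC mulrC mulrA.
Qed.

Lemma complex_split m n (z : 'M[C]_(m, n)) :
  z = map_mx toC (map_mx (@complex.Re R) z) + 'i%C *: map_mx toC (map_mx (@complex.Im R) z).
Proof. by apply/matrixP => i j; rewrite !mxE -complexE. Qed.

Lemma complex_mx_eq0 m n (p q : 'M[R]_(m, n)) :
  map_mx toC p + 'i%C *: map_mx toC q = 0 -> p = 0 /\ q = 0.
Proof.
move=> /matrixP pq0; have pq i j : toC (p i j) + 'i%C * toC (q i j) = 0.
  by have := pq0 i j; rewrite !mxE.
by split; apply/matrixP => i j; have := pq i j;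
   rewrite -(complexE (Complex (p i j) (q i j))) mxE => -[].
Qed.

Lemma sum_spectral_qform n (M P : 'M[R]_n) U (lam : 'I_n -> R) (z : 'rV[C]_n) :
  M^T = M -> map_mx toC M = U^t* *m diag_mx (\row_i toC (lam i)) *m U ->
  \sum_i toC (lam i) * `|(z *m (map_mx toC P *m U^t*)) 0 i| ^+ 2 =
  toC (qform M (map_mx (@complex.Re R) z *m P) + qform M (map_mx (@complex.Im R) z *m P)).
Proof.
move=> symM defM; rewrite -complex_qform // mulmxA -(qformM_spectral _ defM).
have -> : z *m map_mx toC P = map_mx toC (map_mx (@complex.Re R) z *m P)
            + 'i%C *: map_mx toC (map_mx (@complex.Im R) z *m P).
  by rewrite {1}[z]complex_split mulmxDl -scalemxAl -!map_mxM.
by [].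
Qed.

Lemma qform0 n (M : 'M[R]_n) : qform M 0 = 0.
Proof. by rewrite /qform !mul0mx mxE. Qed.

(** If there were fewer negative eigenvalues than elements of [A], some nonzero z supported on [A]
    would have an image under [P] without components along the negative eigenvectors. The form would
    be nonnegative there, although the nonzero parts among Re z and Im z make it negative. *)
Lemma neg_inertia_ge n (M P : 'M[R]_n) (A : {set 'I_n}) : M^T = M ->
  (forall w : 'rV[R]_n, w != 0 -> (forall i, i \notin A -> w 0 i = 0) ->
     qform M (w *m P) < 0) ->
  (#|A| <= neg_inertia M)%N.
Proof.
move=> symM negA; have [U [lam [Uu defM cpM]]] := sym_spectral symM.
rewrite (neg_inertia_prod cpM) leqNgt; apply/negP => ltA.
have [|z [z0 zA zN]] := @kernel_avoid _ n (map_mx toC P *m U^t*) (~: A) [set i | lam i < 0].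
  by have := cardsC A; rewrite card_ord => eqn; rewrite -[X in (_ < X)%N]eqn addnC ltn_add2r.
have := sum_spectral_qform P z symM defM.
have : 0 <= \sum_i toC (lam i) * `|(z *m (map_mx toC P *m U^t*)) 0 i| ^+ 2.
  apply: sumr_ge0 => i _; have [lam0|lam0] := boolP (i \in [set i | lam i < 0]).
    by rewrite zN // normr0 expr0n mulr0.
  by rewrite mulr_ge0 ?exprn_ge0 // ler0c leNgt; move: lam0; rewrite inE.
move=> + eqs; rewrite {}eqs ler0c leNgt => /negP; apply.
have suppA (f : C -> R) : f 0 = 0 -> (forall i, i \notin A -> (map_mx f z) 0 i = 0).
  by move=> f0 i iA; rewrite mxE zA // inE.
have reA := suppA _ (erefl : complex.Re 0 = 0 :> R).
have imA := suppA _ (erefl : complex.Im 0 = 0 :> R).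
have [re0|/negA/(_ reA) ltre] := eqVneq (map_mx (@complex.Re R) z) 0;
have [im0|/negA/(_ imA) ltim] := eqVneq (map_mx (@complex.Im R) z) 0.
- by case/eqP: z0; rewrite [z]complex_split re0 im0 !map_mx0 scaler0 addr0.
- by rewrite re0 mul0mx qform0 add0r.
- by rewrite im0 mul0mx qform0 addr0.
- by rewrite -[0]addr0 ltrD.
Qed.

(** Otherwise some nonzero z supported on [A] would be mapped by [P] into the span of the negative
    eigenvectors. The form is then both nonnegative and nonpositive at the image, so the image is 0,
    and injectivity of [P] on these vectors gives z = 0. *)
Lemma neg_inertia_le n (M P : 'M[R]_n) (A : {set 'I_n}) : M^T = M ->
  (forall w : 'rV[R]_n, (forall i, i \notin A -> w 0 i = 0) ->
     0 <= qform M (w *m P) /\ (w *m P = 0 -> w = 0)) ->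
  (neg_inertia M + #|A| <= n)%N.
Proof.
move=> symM posA; have [U [lam [Uu defM cpM]]] := sym_spectral symM.
rewrite (neg_inertia_prod cpM) leqNgt; apply/negP => ltA.
have [|z [z0 zA zN]] := @kernel_avoid _ n (map_mx toC P *m U^t*) (~: A) (~: [set i | lam i < 0]).
  move: ltA (cardsC A) (cardsC [set i | lam i < 0]); rewrite card_ord.
  by move: #|A| #|~: A| #|[set i | _]| #|~: [set i | _]| => *; lia.
have suppA (f : C -> R) : f 0 = 0 -> (forall i, i \notin A -> (map_mx f z) 0 i = 0).
  by move=> f0 i iA; rewrite mxE zA // inE.
have [re_ge0 re0] := posA _ (suppA _ (erefl : complex.Re 0 = 0 :> R)).
have [im_ge0 im0] := posA _ (suppA _ (erefl : complex.Im 0 = 0 :> R)).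
set y := z *m (map_mx toC P *m U^t*) in zN.
have eqs := sum_spectral_qform P z symM defM.
have t_ge0 i : 0 <= - (toC (lam i) * `|y 0 i| ^+ 2).
  rewrite -mulNr -rmorphN; have [lam0|lam0] := boolP (i \in ~: [set i | lam i < 0]).
    by rewrite zN // normr0 expr0n mulr0.
  rewrite mulr_ge0 ?exprn_ge0 // ler0c oppr_ge0 ltW //.
  by move: lam0; rewrite !inE negbK.
have s_eq0 : toC (qform M (map_mx (@complex.Re R) z *m P) +
                  qform M (map_mx (@complex.Im R) z *m P)) = 0.
  apply/le_anti; rewrite ler0c addr_ge0 // andbT -eqs -oppr_ge0 -sumrN.
  exact: sumr_ge0.
have y0 : y = 0.
  have /eqP := eqs; rewrite s_eq0 -oppr_eq0 -sumrN psumr_eq0 // => /allP t0.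
  apply/rowP => i; rewrite [RHS]mxE.
  have [lam0|lam0] := boolP (i \in ~: [set i | lam i < 0]); first exact: zN.
  have := t0 i (mem_index_enum i); rewrite oppr_eq0 mulf_eq0 expf_eq0 normr_eq0 /=.
  case/orP => /eqP // /complexI lami.
  by move: lam0; rewrite !inE lami ltxx.
have zP : z *m map_mx toC P = 0.
  have U'u : U^t* \in unitmx by rewrite map_unitmx unitmx_tr.
  by rewrite -[LHS](mulmxK U'u) -(mulmxA z (map_mx toC P)) -/y y0 mul0mx.
rewrite {1}[z]complex_split mulmxDl -scalemxAl -!map_mxM in zP.
have [rez imz] := complex_mx_eq0 zP.
case/eqP: z0; apply/rowP => j; apply/eqP; rewrite mxE eq_complex /=.
move/rowP/(_ j): (re0 rez); rewrite !mxE => ->.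
by move/rowP/(_ j): (im0 imz); rewrite !mxE => ->; rewrite eqxx.
Qed.
End Inertia.

(** * The squared distance form of a tree *)

Section TreeForm.
Local Open Scope ring_scope.
Variables (R : realFieldType) (T : finType) (E : rel T) (d : T -> T -> nat).
Hypothesis Esym : symmetric E.
Hypothesis d0 : forall x, d x x = 0%N.
Hypothesis dsym : forall x y, d x y = d y x.
Hypothesis dE : forall x y, E x y -> d x y = 1%N.
(** This is how the tree enters: exactly one neighbour of v lies one step nearer to j, and all the
    others lie one step farther. *)
Hypothesis closer : forall v j, v != j ->
  exists w, [/\ E v w, d v j = (d w j).+1 &
                forall w', E v w' -> w' != w -> d w' j = (d v j).+1].

Definition ndeg v : R := #|[set w | E v w]|%:R.
Definition tau v : R := 2 - ndeg v.
Definition lap (f : T -> R) v : R := \sum_(w | E v w) (f v - f w).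

Let ndegE v : \sum_(w | E v w) 1 = ndeg v.
Proof. by rewrite /ndeg cardsE -sum1_card natr_sum. Qed.

Lemma sum_mul_lap (f g : T -> R) : \sum_v f v * lap g v = \sum_v g v * lap f v.
Proof.
have lapE (p q : T -> R) : \sum_v p v * lap q v =
    \sum_v p v * q v * ndeg v - \sum_v \sum_(w | E v w) p v * q w.
  rewrite -sumrB; apply: eq_bigr => v _; rewrite -ndegE !mulr_sumr -sumrB.
  by apply: eq_bigr => w _; rewrite mulrBr mulr1.
rewrite !lapE; congr (_ - _); first by apply: eq_bigr => v _; rewrite [f v * _]mulrC.
rewrite (exchange_big_dep predT) //=; apply: eq_bigr => v _.
by apply: eq_big => w; rewrite 1?Esym // mulrC.
Qed.

Lemma lap_const (k : R) v : lap (fun=> k) v = 0.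
Proof. by rewrite /lap big1 // => w _; rewrite subrr. Qed.

Lemma lap_dist_self (g : nat -> R) j :
  lap (fun v => g (d v j)) j = ndeg j * (g 0%N - g 1%N).
Proof.
rewrite -ndegE mulr_suml; apply: eq_bigr => w Ejw.
by rewrite d0 dsym (dE Ejw) mul1r.
Qed.

(** One neighbour contributes g(d) - g(d-1), the remaining deg - 1 neighbours contribute g(d) -
    g(d+1). *)
Lemma lap_dist (g : nat -> R) j v : v != j ->
  lap (fun v => g (d v j)) v =
   ndeg v * (g (d v j) - g (d v j).+1) + (g (d v j).+1 - g (d v j).-1).
Proof.
case/closer => w [Evw dvw far]; rewrite -ndegE /lap !(bigD1 w Evw) /= mulrDl.
rewrite mulr_suml (eq_bigr (fun _ => 1 * (g (d v j) - g (d v j).+1))).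
  by rewrite dvw /=; ring.
by move=> w' /andP[Ew' nw]; rewrite /= mul1r (far w').
Qed.

Lemma lap_dist1 j v : lap (fun v => (d v j)%:R) v = tau v - 2 * (v == j)%:R.
Proof.
have [->|vj] := eqVneq v j; first by rewrite (lap_dist_self (fun k => k%:R)) /tau /=; ring.
rewrite (lap_dist (fun k => k%:R)) // /tau.
by have [w [_ -> _]] := closer vj; rewrite /= -!natr1; ring.
Qed.

Lemma lap_dist2 j v :
  lap (fun v => (d v j)%:R ^+ 2) v = 2 * tau v * (d v j)%:R - ndeg v.
Proof.
have [->|vj] := eqVneq v j.
  by rewrite (lap_dist_self (fun k => k%:R ^+ 2)) /tau d0 /=; ring.
rewrite (lap_dist (fun k => k%:R ^+ 2)) // /tau.
by have [w [_ -> _]] := closer vj; rewrite /= -!natr1; ring.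
Qed.

Lemma lap_dist3 j v :
  lap (fun v => (d v j)%:R ^+ 3) v = 3 * (tau v * (d v j)%:R ^+ 2 - ndeg v * (d v j)%:R)
    + tau v - 2 * (v == j)%:R.
Proof.
have [->|vj] := eqVneq v j.
  by rewrite (lap_dist_self (fun k => k%:R ^+ 3)) /tau d0 /=; ring.
rewrite (lap_dist (fun k => k%:R ^+ 3)) // /tau.
by have [w [_ -> _]] := closer vj; rewrite /= -!natr1; ring.
Qed.

Lemma sum_lap f : \sum_v lap f v = 0.
Proof.
under eq_bigr do rewrite -[lap f _]mul1r.
by rewrite sum_mul_lap big1 // => v _; rewrite lap_const mulr0.
Qed.

Let sum_delta j (f : T -> R) : \sum_v f v * (v == j)%:R = f j.
Proof.
rewrite (bigD1 j) //= eqxx mulr1 big1 ?addr0 // => v /negPf->.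
by rewrite mulr0.
Qed.

(** For a tree this is 2|V| - 2|E| = 2. Here it comes from summing the Laplacian of d(.,j) over all
    vertices; [j] supplies the base vertex. *)
Lemma sum_tau (j : T) : \sum_v tau v = 2.
Proof.
have := sum_lap (fun v => (d v j)%:R); under eq_bigr do rewrite lap_dist1.
by rewrite sumrB (sum_delta j (fun=> 2)) => /eqP; rewrite subr_eq0 => /eqP.
Qed.

Lemma sum_tau_sqr j :
  \sum_v (tau v * (d v j)%:R ^+ 2 - ndeg v * (d v j)%:R) = 0.
Proof.
have := sum_lap (fun v => (d v j)%:R ^+ 3); under eq_bigr do rewrite lap_dist3.
rewrite sumrB (sum_delta j (fun=> 2)) big_split /= (sum_tau j) -mulr_sumr => eq0.
by lra.
Qed.

(** Pairing u with d(.,j) and moving the Laplacian onto the distance gives a value that does not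
    depend on [j]: harmonic functions are constant. *)
Lemma lap_eq0 (u : T -> R) j : (forall v, lap u v = 0) ->
  2 * u j = \sum_v u v * tau v.
Proof.
move=> u0; have := sum_mul_lap (fun v => (d v j)%:R) u.
rewrite big1 => [|v _]; last by rewrite u0 mulr0.
under eq_bigr do rewrite lap_dist1 mulrBr mulrA.
rewrite sumrB (sum_delta j (fun v => u v * 2)) => /esym/eqP.
by rewrite subr_eq0 => /eqP ->; rewrite mulrC.
Qed.

(** * The squared distance form in the coordinates (u, s) *)

Section Form.
Variables (a : T) (u : T -> R) (s : R).

(** The constant 1/2 makes the mixed term at v equal to -4 (tau v + deg v) s u_v = -8 s u_v, so that
    a square (u_v + s)^2 appears wherever tau v = 1. *)
Definition shifted v := u v + s * ((d v a)%:R + 2^-1).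
Definition lap_shifted v := lap shifted v + 2 * s * (v == a)%:R.
Local Notation y := shifted.
Local Notation x := lap_shifted.
Definition tau_shifted := \sum_v tau v * y v.

Let sum_x (F : T -> R) : \sum_v x v * F v = \sum_v y v * lap F v + 2 * s * F a.
Proof.
under eq_bigr do rewrite mulrDl.
rewrite big_split /=; congr (_ + _).
  by rewrite -sum_mul_lap; apply: eq_bigr => v _; rewrite mulrC.
under eq_bigr do rewrite mulrAC.
by rewrite (sum_delta a (fun v => 2 * s * F v)).
Qed.

(** Moving the Laplacian in x onto d^2 leaves an expression linear in d; moving the second one onto
    d leaves sums over single vertices. *)
Lemma tree_form : \sum_i \sum_j (d i j)%:R ^+ 2 * (x i * x j) =
  2 * tau_shifted ^+ 2 + 2 * s ^+ 2 
  - 4 * \sum_v (tau v * u v ^+ 2 + 2 * s * u v + s ^+ 2).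
Proof.
have x1 : \sum_v x v = 2 * s.
  under eq_bigr do rewrite -[x _]mulr1.
  by rewrite sum_x big1 ?add0r ?mulr1 // => v _; rewrite lap_const mulr0.
have xd i : \sum_v x v * (d v i)%:R = tau_shifted - 2 * y i + 2 * s * (d i a)%:R.
  rewrite (sum_x (fun v => (d v i)%:R)) dsym; congr (_ + _).
  under eq_bigr do rewrite lap_dist1 mulrBr mulrA.
  rewrite sumrB (sum_delta i (fun v => y v * 2)) [2 * _]mulrC; congr (_ - _).
  by apply: eq_bigr => v _; rewrite mulrC.
have xd2 j : \sum_v x v * (d v j)%:R ^+ 2 =
    \sum_v y v * (2 * tau v * (d v j)%:R - ndeg v) + 2 * s * (d j a)%:R ^+ 2.
  rewrite (sum_x (fun v => (d v j)%:R ^+ 2)) dsym; congr (_ + _).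
  by apply: eq_bigr => v _; rewrite lap_dist2.
have -> : \sum_i \sum_j (d i j)%:R ^+ 2 * (x i * x j) =
    \sum_j x j * \sum_v x v * (d v j)%:R ^+ 2.
  rewrite exchange_big /=; apply: eq_bigr => j _; rewrite mulr_sumr.
  by apply: eq_bigr => i _; ring.
under eq_bigr do rewrite xd2 mulrDr.
rewrite big_split /=.
(* This is [xd2] at [a], where the last term vanishes since d a a = 0. *)
have -> : \sum_i x i * (2 * s * (d i a)%:R ^+ 2) =
   2 * s * \sum_v y v * (2 * tau v * (d v a)%:R - ndeg v).
  have := xd2 a; rewrite d0 expr0n mulr0 addr0 => <-.
  by rewrite mulr_sumr; apply: eq_bigr => i _; ring.
have -> : \sum_i x i * (\sum_v y v * (2 * tau v * (d v i)%:R - ndeg v)) =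
   \sum_v y v * (2 * tau v * (tau_shifted - 2 * y v + 2 * s * (d v a)%:R) - ndeg v * (2 * s)).
  under eq_bigr do rewrite mulr_sumr.
  rewrite exchange_big /=; apply: eq_bigr => v _; rewrite -xd -x1.
  rewrite !mulr_sumr -sumrB mulr_sumr; apply: eq_bigr => i _.
  by rewrite (dsym v i); ring.
have -> : 2 * tau_shifted ^+ 2 = \sum_v 2 * tau_shifted * (tau v * y v).
  by rewrite -mulr_sumr -/tau_shifted; ring.
(* Writing 2 s^2 as a vertex sum, with a multiple of the vanishing sum [sum_tau_sqr] added, allows
   the identity to be checked vertex by vertex. *)
have -> : 2 * s ^+ 2 = \sum_v (s ^+ 2 * tau v
    + 4 * s ^+ 2 * (tau v * (d v a)%:R ^+ 2 - ndeg v * (d v a)%:R)).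
  by rewrite big_split /= -!mulr_sumr (sum_tau a) sum_tau_sqr; ring.
rewrite [4 * \sum_v _]mulr_sumr [2 * s * \sum_v _]mulr_sumr -!big_split /= -sumrB.
by apply: eq_bigr => v _; rewrite /shifted /tau; field.
Qed.

Lemma lap_shifted_leaf c : E a =1 pred1 c -> x a = u a - u c + s.
Proof.
move=> Ea; rewrite /lap_shifted eqxx /lap (eq_bigl _ _ Ea) big_pred1_eq.
have Eac : E a c by rewrite Ea /= eqxx.
by rewrite /shifted d0 dsym (dE Eac) /=; field.
Qed.
End Form.
End TreeForm.

(** * Graph distance and cycles *)

Section Distance.
Variables (n : nat) (e : rel 'I_n).

Lemma walk_of_lenP k x y :
  reflect (exists p, [/\ size p = k, path e x p & last x p = y]) (walk_of_len e k x y).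
Proof.
apply: (iffP existsP) => [[p /andP[xp /eqP py]]|[p [<- xp py]]].
  by exists p; rewrite size_tuple.
by exists (in_tuple p); rewrite xp py eqxx.
Qed.

Lemma size_uniq_ord (x : 'I_n) p : uniq (x :: p) -> size p < n.
Proof. by move/card_uniqP => /= <-; rewrite -[leqRHS]card_ord max_card. Qed.

(** The walk may be longer than the range searched by [gdist]; removing repetitions gives one of
    length below n, which the search does see. *)
Lemma gdist_min x p : path e x p -> gdist e x (last x p) <= size p.
Proof.
case/shortenP=> p' xp' up' p'p; set y := last x p'.
apply: leq_trans (uniq_leq_size _ p'p); last by case/andP: up'.
have lt_p'n := size_uniq_ord up'.
rewrite leqNgt; apply/negP => /(before_find 0) /=.
by rewrite nth_iota // => /walk_of_lenP; apply; exists p'.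
Qed.

Lemma gdist_walk x y : connect e x y ->
  exists p, [/\ size p = gdist e x y, path e x p & last x p = y].
Proof.
case/connectP => p xp ->; case/shortenP: xp => p' xp' up' _.
set y' := last x p'; apply/walk_of_lenP.
have lt_p'n := size_uniq_ord up'.
have w : has (fun k => walk_of_len e k x y') (iota 0 n).
  apply/hasP; exists (size p'); first by rewrite mem_iota.
  by apply/walk_of_lenP; exists p'.
have := nth_find 0 w; rewrite nth_iota //.
by rewrite -[X in _ < X](size_iota 0) -has_find.
Qed.

Hypothesis esym : symmetric e.
Hypothesis eirr : irreflexive e.
Hypothesis econ : connected_graph e.

Lemma gdistxx x : gdist e x x = 0.
Proof. by apply/eqP; rewrite -leqn0; exact: (@gdist_min x [::]). Qed.

Lemma gdist_eq0 x y : gdist e x y = 0 -> x = y.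
Proof. by have [p [<- _ <-]] := gdist_walk (econ x y) => /size0nil ->. Qed.

Lemma gdist_step x y z : e x y -> gdist e x z <= (gdist e y z).+1.
Proof.
move=> exy; have [p [<- yp <-]] := gdist_walk (econ y z).
by apply: (@gdist_min x (y :: p)); rewrite /= exy.
Qed.

Lemma gdist_closer x z : x != z -> exists2 y, e x y & gdist e x z = (gdist e y z).+1.
Proof.
have [[|y p] [/= sz xp lst]] := gdist_walk (econ x z).
  by rewrite lst eqxx.
move=> _; case/andP: xp => exy yp; exists y => //; apply/eqP.
by rewrite eqn_leq gdist_step // -sz ltnS -lst gdist_min.
Qed.

Lemma gdist_sym x y : gdist e x y = gdist e y x.
Proof.
wlog suff: x y / gdist e x y <= gdist e y x.
  by move=> H; apply/eqP; rewrite eqn_leq !H.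
have [p [<- yp <-]] := gdist_walk (econ y x).
have := @gdist_min (last y p) (rev (belast y p)); rewrite size_rev size_belast.
have -> : last (last y p) (rev (belast y p)) = y.
  by case: (p) => //= z q; rewrite rev_cons last_rcons.
apply; rewrite rev_path; apply: sub_path yp => u v /=.
by rewrite esym.
Qed.

Lemma gdist_edge x y : e x y -> gdist e x y = 1.
Proof.
move=> exy; apply/eqP; rewrite eqn_leq -{1}(gdistxx y) gdist_step //= lt0n.
by apply/eqP => /gdist_eq0 eqxy; rewrite eqxy eirr in exy.
Qed.

(** Shortest walks from w1 and w2 to j avoid v, so w1 and w2 are joined by a path in the graph
    without v. Together with v this path closes to a cycle. *)
Lemma closer_cycle v w1 w2 j : e v w1 -> e v w2 -> w1 != w2 ->
    gdist e w1 j <= gdist e v j -> gdist e w2 j <= gdist e v j ->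
  exists2 s, is_cycle e s & [&& v \in s, w1 \in s & w2 \in s].
Proof.
move=> ev1 ev2 neq12 le1 le2; pose e' := [rel x y | [&& e x y, x != v & y != v]].
have avoid w : e v w -> gdist e w j <= gdist e v j -> connect e' w j.
  move=> evw lew; have [p [szp wp lastp]] := gdist_walk (econ w j).
  have neqwv : w != v by apply: contraTneq evw => ->; rewrite eirr.
  (* If the geodesic from w met v, its part after v would make v strictly nearer to j than w. *)
  have vp : v \notin p.
    apply/negP => /splitPr vp; case: vp szp wp lastp => p1 p2 szp.
    rewrite cat_path last_cat /= => /and3P[_ _ vp2] lastp.
    have := gdist_min vp2; rewrite lastp leqNgt => /negP; apply.
    by apply: leq_trans lew; rewrite -szp size_cat /= addnS ltnS leq_addl.
  apply/connectP; exists p => //.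
  elim: p w neqwv wp vp {evw lew szp lastp} => //= z p IH w nwv /andP[ewz zp].
  rewrite inE negb_or eq_sym => /andP[nzv vp].
  by rewrite ewz nwv nzv IH.
have e'sym : connect_sym e'.
  by apply: sym_connect_sym => x y /=; rewrite esym [(x != v) && _]andbC.
have : connect e' w1 w2.
  by apply: connect_trans (avoid _ ev1 le1) _; rewrite e'sym avoid.
case/connectP => p0 p0p lastp0; case/shortenP: p0p lastp0 => p w1p up _ lastp.
exists (v :: w1 :: p); last first.
  have w2p : w2 \in w1 :: p by rewrite lastp mem_last.
  by rewrite mem_head in_cons mem_head orbT in_cons w2p orbT.
have e'P : path e w1 p && (v \notin p).
  elim: p w1 w1p {ev1 neq12 le1 up lastp} => //= z p IH w.
  by case/andP=> /and3P[-> _ nzv] /IH/andP[-> vp]; rewrite inE eq_sym negb_or nzv.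
case/andP: e'P => pe vp; rewrite /is_cycle -andbA; apply/and3P; split.
- rewrite /= !ltnS lt0n. apply: contra neq12; rewrite size_eq0 => /eqP p_nil.
  by rewrite lastp p_nil.
- rewrite cons_uniq up inE negb_or vp !andbT.
  by apply: contraTneq ev1 => ->; rewrite eirr.
- by rewrite /= ev1 rcons_path pe -lastp esym.
Qed.
End Distance.

Lemma card_lift n (b : 'I_n.+1) (P : pred 'I_n.+1) :
  #|[set k | P k]| = (P b + #|[set i | P (lift b i)]|)%N.
Proof.
rewrite !cardsE -!sum1_card !big_mkcond /= (bigD1_ord b) //=.
by congr (_ + _)%N; rewrite [RHS]big_mkcond.
Qed.

(** * Triangle with a tree attached at c *)

Section Triangle.
Local Open Scope ring_scope.
Variables (m : nat) (e : rel 'I_m.+1).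
Hypothesis esym : symmetric e.
Hypothesis eirr : irreflexive e.
Hypothesis econ : connected_graph e.
Variables (a b c : 'I_m.+1).
Hypothesis eab : e a b.
Hypothesis nbr_a : forall x, e a x = (x == b) || (x == c).
Hypothesis nbr_b : forall x, e b x = (x == a) || (x == c).
Hypothesis cyc : forall s, is_cycle e s -> [set x in s] = [set a; b; c].

Let neq_ab : a != b. Proof. by apply: contraTneq eab => ->; rewrite eirr. Qed.
Let eac : e a c. Proof. by rewrite nbr_a eqxx orbT. Qed.
Let ebc : e b c. Proof. by rewrite nbr_b eqxx orbT. Qed.
Let neq_ac : a != c. Proof. by apply: contraTneq eac => ->; rewrite eirr. Qed.
Let neq_bc : b != c. Proof. by apply: contraTneq ebc => ->; rewrite eirr. Qed.

Local Notation D := (gdist e).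
Let E : rel 'I_m := fun i j => e (lift b i) (lift b j).
Let d (i j : 'I_m) := D (lift b i) (lift b j).

(* Two such neighbours would lie with v on a cycle, hence {v, w1, w2} would be the
   triangle, which contains b. *)
Let no_two_closer v w1 w2 j : v != b -> w1 != b -> w2 != b -> e v w1 -> e v w2 ->
  w1 != w2 -> (D w1 j <= D v j)%N -> (D w2 j <= D v j)%N -> False.
Proof.
move=> vb w1b w2b ev1 ev2 neq12 le1 le2.
have [s /cyc sC /and3P[vs w1s w2s]] := closer_cycle esym eirr econ ev1 ev2 neq12 le1 le2.
have sub4 : [set v; w1; w2; b] \subset [set a; b; c].
  have bs : b \in [set x in s] by rewrite sC !inE eqxx orbT.
  rewrite inE in bs; rewrite -sC; apply/subsetP => x; rewrite !inE.
  by case/orP => [/orP[/orP[]|]|] /eqP->.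
have := subset_leq_card sub4.
have nv1 : v != w1 by apply: contraTneq ev1 => ->; rewrite eirr.
have nv2 : v != w2 by apply: contraTneq ev2 => ->; rewrite eirr.
rewrite -!setUA !cardsU1 !cards1 !inE !negb_or nv1 nv2 vb neq12 w1b w2b /=.
by rewrite neq_ab neq_ac neq_bc.
Qed.

(** The first step of a geodesic from a leads to b or to c, which is adjacent to b; the same holds
    with a and b exchanged. *)
Let dist_twin j : j != a -> j != b -> D b j = D a j.
Proof.
move=> ja jb; apply/eqP; rewrite eqn_leq; apply/andP; split.
  have [w] := gdist_closer econ (x := a) (z := j) ltac:(by rewrite eq_sym).
  rewrite nbr_a => /orP[]/eqP-> ->; first exact: leqW.
  exact: gdist_step.
have [w] := gdist_closer econ (x := b) (z := j) ltac:(by rewrite eq_sym).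
rewrite nbr_b => /orP[]/eqP-> ->; first exact: leqW.
exact: gdist_step.
Qed.

Let E_sym : symmetric E. Proof. by move=> i j; rewrite /E esym. Qed.
Let d_diag i : d i i = 0%N. Proof. exact: gdistxx. Qed.
Let d_sym i j : d i j = d j i. Proof. exact: gdist_sym. Qed.
Let d_edge i j : E i j -> d i j = 1%N. Proof. by move=> eij; apply: gdist_edge. Qed.

(** The graph without b, with the distances of the whole graph, satisfies the tree hypothesis
    [closer]. *)
Let d_closer v j : v != j ->
  exists w, [/\ E v w, d v j = (d w j).+1 &
                forall w', E v w' -> w' != w -> d w' j = (d v j).+1].
Proof.
move=> neq_vj; have neqL : lift b v != lift b j by rewrite (inj_eq lift_inj).
have nb (i : 'I_m) : lift b i != b by rewrite eq_sym neq_lift.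
have [w evw Dw] := gdist_closer econ neqL.
(* A geodesic does not pass through b: the vertices before and after b would be among a and c, hence
   equal or adjacent, which allows a shortcut. *)
have wb : w != b.
  apply/eqP => wb; rewrite {w}wb in evw Dw.
  have [w2 eb2 Dw2] := gdist_closer econ (x := b) (z := lift b j) (neq_lift _ _).
  have : (D (lift b v) (lift b j) <= (D w2 (lift b j)).+1)%N.
    move: evw eb2; rewrite esym !nbr_b => /orP[]/eqP-> /orP[]/eqP->;
      by rewrite ?leqnSn // gdist_step // 1?esym.
  by rewrite Dw Dw2 ltnn.
have [w0 eqw|eqw] := unliftP b w; last by rewrite eqw eqxx in wb.
rewrite {w}eqw in evw Dw wb; exists w0; split=> // w' evw' neqw.
apply/eqP; rewrite eqn_leq gdist_step //=; last by rewrite esym.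
rewrite ltnNge; apply/negP => le_w'.
apply: (no_two_closer (nb v) (nb w') (nb w0) evw' evw _ le_w'); rewrite ?Dw ?leqnSn //.
by rewrite (inj_eq lift_inj).
Qed.

(** * The squared distance form of the whole graph *)

Variable R : rcfType.
Local Notation Delta := (dist_sq_mx R e).

Lemma dist_sq_mx_sym : Delta^T = Delta.
Proof. by apply/matrixP => i j; rewrite !mxE gdist_sym. Qed.

Lemma qform_dist_sq_mx (X : 'rV[R]_m.+1) :
  qform Delta X = \sum_i \sum_j (D i j)%:R ^+ 2 * (X 0 i * X 0 j).
Proof.
rewrite /qform mxE; under eq_bigr do rewrite mxE mulr_suml.
rewrite exchange_big /=; apply: eq_bigr => i _; apply: eq_bigr => j _.
by rewrite !mxE natrX; ring.
Qed.

Variable a' : 'I_m.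
Hypothesis def_a : a = lift b a'.

(** The weight of b is moved onto its twin a. Only the pair a, b sees a difference: its distance is
    1 instead of 0, which yields 2 X_a X_b. *)
Lemma qform_twin (X : 'rV[R]_m.+1) (x : 'I_m -> R) :
    (forall i, x i = X 0 (lift b i) + (i == a')%:R * X 0 b) ->
  qform Delta X = \sum_i \sum_j (d i j)%:R ^+ 2 * (x i * x j) + 2 * X 0 a * X 0 b.
Proof.
move=> defx; rewrite qform_dist_sq_mx.
pose z i := X 0 (lift b i); set B := X 0 b.
have Db j : (D b (lift b j))%:R ^+ 2 = (d a' j)%:R ^+ 2 + (j == a')%:R :> R.
  have [->|neq] := eqVneq j a'; first by rewrite d_diag -def_a gdist_edge 1?esym //=; ring.
  rewrite addr0 dist_twin //; first by rewrite /d def_a.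
    by rewrite def_a (inj_eq lift_inj).
  by rewrite eq_sym neq_lift.
have delta (f : 'I_m -> R) : \sum_i (i == a')%:R * f i = f a'.
  rewrite (bigD1 a') //= eqxx mul1r big1 ?addr0 // => i /negPf->.
  by rewrite mul0r.
pose S := \sum_i \sum_j (d i j)%:R ^+ 2 * (z i * z j).
pose L := \sum_j (d a' j)%:R ^+ 2 * z j.
have -> : \sum_i \sum_j (d i j)%:R ^+ 2 * (x i * x j) = S + 2 * B * L.
  transitivity (\sum_i (\sum_j (d i j)%:R ^+ 2 * (z i * z j) + (d i a')%:R ^+ 2 * z i * B
     + (i == a')%:R * (B * \sum_j (d i j)%:R ^+ 2 * x j))).
    apply: eq_bigr => i _.
    rewrite -(delta (fun j => (d i j)%:R ^+ 2 * z i * B)) -big_split /=.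
    rewrite !mulr_sumr -big_split /=; apply: eq_bigr => j _.
    by rewrite !defx -/(z i) -/(z j) -/B; ring.
  rewrite big_split big_split /= -/S delta -addrA; congr (_ + _).
  have -> : \sum_j (d a' j)%:R ^+ 2 * x j = L.
    rewrite -[RHS]addr0 -[X in L + X](_ : (d a' a')%:R ^+ 2 * B = 0); last first.
      by rewrite d_diag; ring.
    rewrite -(delta (fun j => (d a' j)%:R ^+ 2 * B)) -big_split /=.
    by apply: eq_bigr => j _; rewrite defx -/(z j) -/B; ring.
  rewrite -mulr_suml -/L; under eq_bigr do rewrite d_sym.
  by rewrite -/L; ring.
have -> : X 0 a = z a' by rewrite def_a.
rewrite (bigD1_ord b) //= [X in X + _](bigD1_ord b) //= gdistxx.
rewrite [X in _ + X](eq_bigr (fun i : 'I_m => (D b (lift b i))%:R ^+ 2 * (B * z i)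
   + \sum_j (d i j)%:R ^+ 2 * (z i * z j))); last first.
  move=> i _; rewrite (bigD1_ord b) //= gdist_sym //.
  by rewrite [z i * _]mulrC.
have -> : \sum_(i < m) (D b (lift b i))%:R ^+ 2 * (X 0 b * X 0 (lift b i)) = B * (L + z a').
  rewrite -(delta z) /L -big_split /= mulr_sumr; apply: eq_bigr => i _.
  by rewrite Db -/(z i) -/B; ring.
rewrite big_split /= -/S.
have -> : \sum_(i < m) (D b (lift b i))%:R ^+ 2 * (B * z i) = B * (L + z a').
  rewrite -(delta z) /L -big_split /= mulr_sumr; apply: eq_bigr => i _.
  by rewrite Db; ring.
ring.
Qed.

(* The slot b of w carries the parameter s, the other slots are the coordinates u
   on the tree, whose vertices are the lift b i. *)
Definition twin_x (w : 'rV[R]_m.+1) : 'I_m -> R :=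
  lap_shifted E d a' (fun i => w 0 (lift b i)) (w 0 b).
(** With T = [tau_shifted] and X_b = x_a/2 - T, the other twin gets X_a = x_a/2 + T. Then 2 X_a X_b
    = x_a^2/2 - 2 T^2 cancels the term 2 T^2 of [tree_form]. *)
Definition twin_b (w : 'rV[R]_m.+1) : R :=
  twin_x w a' / 2 - tau_shifted E d a' (fun i => w 0 (lift b i)) (w 0 b).
Definition twin_map (w : 'rV[R]_m.+1) : 'rV[R]_m.+1 :=
  \row_k if unlift b k is Some i then twin_x w i - (i == a')%:R * twin_b w else twin_b w.

Lemma twin_map_linear : linear twin_map.
Proof.
move=> k w1 w2.
have xlin i : twin_x (k *: w1 + w2) i = k * twin_x w1 i + twin_x w2 i.
  rewrite /twin_x /lap_shifted /lap mulrDr mulr_sumr [RHS]addrACA -big_split /=.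
  congr (_ + _); last by rewrite !mxE; ring.
  by apply: eq_bigr => j _; rewrite /shifted !mxE; ring.
have blin : twin_b (k *: w1 + w2) = k * twin_b w1 + twin_b w2.
  rewrite /twin_b xlin [tau_shifted _ _ _ _ _](_ : _ =
    k * tau_shifted E d a' (fun i => w1 0 (lift b i)) (w1 0 b)
    + tau_shifted E d a' (fun i => w2 0 (lift b i)) (w2 0 b)); first by ring.
  rewrite /tau_shifted mulr_sumr -big_split /=.
  by apply: eq_bigr => j _; rewrite /shifted !mxE; ring.
apply/rowP => j; rewrite !mxE blin; case: (unlift b j) => // i.
by rewrite xlin; ring.
Qed.

Variable c' : 'I_m.
Hypothesis def_c : c = lift b c'.

Let E_a : E a' =1 pred1 c'.
Proof.
move=> i; rewrite /E -def_a nbr_a eq_sym (negPf (neq_lift _ _)) /= def_c.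
by rewrite (inj_eq lift_inj).
Qed.

Lemma qform_twin_map (w : 'rV[R]_m.+1) :
  qform Delta (twin_map w) = 2 * w 0 b ^+ 2
    - 4 * \sum_i (tau R E i * w 0 (lift b i) ^+ 2 + 2 * w 0 b * w 0 (lift b i) + w 0 b ^+ 2)
    + (w 0 a - w 0 c + w 0 b) ^+ 2 / 2.
Proof.
have Xb : twin_map w 0 b = twin_b w by rewrite mxE unlift_none.
have Xl i : twin_map w 0 (lift b i) = twin_x w i - (i == a')%:R * twin_b w.
  by rewrite mxE liftK.
have Xa : twin_map w 0 a = twin_x w a' - twin_b w by rewrite def_a Xl eqxx mul1r.
rewrite (qform_twin (x := twin_x w)); last by move=> i; rewrite Xb Xl; ring.
rewrite (tree_form E_sym d_diag d_sym d_edge d_closer).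
rewrite Xa Xb /twin_b.
have -> : twin_x w a' = w 0 a - w 0 c + w 0 b.
  by rewrite /twin_x (lap_shifted_leaf d_diag d_sym d_edge _ _ E_a) -def_a -def_c.
by field.
Qed.

(** When s = 0 the vector x is the Laplacian of u. If it vanishes, u is constant, and its value at a
    is 0. *)
Lemma twin_map_inj (w : 'rV[R]_m.+1) : w 0 b = 0 -> w 0 a = 0 -> twin_map w = 0 -> w = 0.
Proof.
move=> wb wa w0.
have b0 : twin_b w = 0 by move/rowP/(_ b): w0; rewrite !mxE unlift_none.
have x0 i : twin_x w i = 0.
  by move/rowP/(_ (lift b i)): w0; rewrite !mxE liftK b0 mulr0 subr0.
pose u (i : 'I_m) : R := w 0 (lift b i).
have lap0 i : lap E u i = 0.
  rewrite -(x0 i) /twin_x /lap_shifted wb mulr0 mul0r addr0.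
  by apply: eq_bigr => j _; rewrite /shifted !mul0r !addr0.
apply/rowP => k; rewrite [RHS]mxE.
case: (unliftP b k) => [i|] -> //.
have := lap_eq0 E_sym d_diag d_sym d_edge d_closer i lap0.
rewrite -(lap_eq0 E_sym d_diag d_sym d_edge d_closer a' lap0) /u -def_a wa mulr0.
by move/eqP; rewrite mulf_eq0 pnatr_eq0 => /eqP.
Qed.

(** Slot b stands for s, and a is a leaf of the tree left after removing b. *)
Definition neg_coords := [set x | deg e x == 1%N] :|: [set a; b].

Let deg_lift i : deg e (lift b i) = (e (lift b i) b + #|[set j | E i j]|)%N.
Proof. exact: (card_lift b (e (lift b i))). Qed.

Let deg_a : deg e a = 2%N.
Proof.
have -> : deg e a = #|[set b; c]| by apply: eq_card => x; rewrite !inE nbr_a.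
by rewrite cards2 neq_bc.
Qed.
Let deg_b : deg e b = 2%N.
Proof.
have -> : deg e b = #|[set a; c]| by apply: eq_card => x; rewrite !inE nbr_b.
by rewrite cards2 neq_ac.
Qed.
Let deg_c : (2 <= deg e c)%N.
Proof.
have -> : 2%N = #|[set a; b]| by rewrite cards2 neq_ab.
by apply/subset_leq_card/subsetP => x; rewrite !inE => /orP[]/eqP->; rewrite esym ?eac ?ebc.
Qed.

Lemma card_neg_coords : #|neg_coords| = (nleaves e + 2)%N.
Proof.
rewrite /neg_coords cardsU cards2 neq_ab [X in (_ - X)%N](_ : _ = 0%N) ?subn0 //.
apply/eqP; rewrite cards_eq0; apply/eqP/setP => x; rewrite !inE.
by apply/negP => /andP[/eqP d1 /orP[]/eqP x_ab]; move: d1; rewrite x_ab ?deg_a ?deg_b.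
Qed.

Let c_notin : c \notin neg_coords.
Proof.
rewrite !inE !negb_or [c == a]eq_sym neq_ac [c == b]eq_sym neq_bc !andbT.
by rewrite gtn_eqF.
Qed.

Let deg_other i : i != a' -> i != c' -> deg e (lift b i) = #|[set j | E i j]|.
Proof.
move=> ia ic; rewrite deg_lift esym nbr_b def_a def_c !(inj_eq lift_inj).
by rewrite (negPf ia) (negPf ic).
Qed.

Let ndeg_a : #|[set j | E a' j]| = 1%N.
Proof. by have := deg_lift a'; rewrite -def_a deg_a eab => -[]. Qed.

Let tau_neg i : lift b i \in neg_coords -> tau R E i = 1.
Proof.
rewrite /tau /ndeg; have [->|ia] := eqVneq i a'; first by move=> _; rewrite ndeg_a; ring.
have [->|ic] := eqVneq i c'; first by rewrite -def_c (negPf c_notin).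
have lb : (lift b i == b) = false by rewrite eq_sym (negPf (neq_lift _ _)).
rewrite !inE (deg_other ia ic) def_a (inj_eq lift_inj) (negPf ia) lb /= orbF.
by move/eqP->; ring.
Qed.

(** Removing b lowers the degree of c by one, so deg c > 2 keeps it at least 2. The other vertices
    here keep their degree, which is neither 1 nor, by connectedness, 0. *)
Let tau_nonneg i : (2 < deg e c)%N -> lift b i \notin neg_coords -> tau R E i <= 0.
Proof.
move=> deg_c3; rewrite /tau /ndeg subr_le0 ler_nat.
have [->|ic] := eqVneq i c'.
  move=> _; have := deg_lift c'; rewrite -def_c esym ebc => eqd.
  by rewrite eqd in deg_c3.
rewrite !inE !negb_or => /and3P[d1 ia _].
have {}ia : i != a' by rewrite def_a (inj_eq lift_inj) in ia.
rewrite deg_other // in d1; move: d1.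
have [w [Eiw _ _]] := d_closer ia.
have : (0 < #|[set j | E i j]|)%N by apply/card_gt0P; exists w; rewrite inE.
by case: #|_| => [|[]].
Qed.

Let twin_map_mx : exists P, forall w, w *m P = twin_map w.
Proof.
pose f : {linear 'rV[R]_m.+1 -> 'rV[R]_m.+1} :=
  HB.pack twin_map (GRing.isLinear.Build R _ _ _ twin_map twin_map_linear).
by exists (lin1_mx f) => w; rewrite mul_rV_lin1.
Qed.

(** * Signs of the form on the two complementary sets of coordinates *)

Lemma neg_coords_le : (#|neg_coords| <= neg_inertia Delta)%N.
Proof.
have [P defP] := twin_map_mx; apply: (neg_inertia_ge (P := P) dist_sq_mx_sym) => w w_neq0 suppw.
rewrite defP qform_twin_map; set s := w 0 b.
set t := fun i : 'I_m => tau R E i * w 0 (lift b i) ^+ 2 + 2 * s * w 0 (lift b i) + s ^+ 2.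
have tA i : lift b i \in neg_coords -> t i = (w 0 (lift b i) + s) ^+ 2.
  by move/tau_neg; rewrite /t => ->; ring.
have tNA i : lift b i \notin neg_coords -> t i = s ^+ 2.
  by move/suppw; rewrite /t => ->; ring.
have t_ge0 i : 0 <= t i.
  by have [/tA|/tNA] := boolP (lift b i \in neg_coords); move=> ->; exact: sqr_ge0.
have neq_ca : c' != a' by move: neq_ac; rewrite def_a def_c (inj_eq lift_inj) eq_sym.
have ta : t a' = (w 0 a + s) ^+ 2 by rewrite def_a tA // -def_a !inE eqxx orbT.
have tc : t c' = s ^+ 2 by rewrite tNA // -def_c.
(* The terms at a and c absorb the positive part: the form is -2 s^2 - (7/2) (w_a + s)^2 - 4 r, with
   r the sum of the remaining t i. *)
rewrite [X in 4 * X](_ : _ = \sum_i t i) // (bigD1 a') //= (bigD1 c') //= ta tc.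
rewrite (suppw c) // subr0.
have : 0 <= \sum_(i | (i != a') && (i != c')) t i by exact: sumr_ge0.
move rest: (\sum_(i | (i != a') && (i != c')) t i) => r r_ge0.
have sq1 := sqr_ge0 s; have sq2 := sqr_ge0 (w 0 a + s).
rewrite ltNge; apply/negP => q_ge0; case/eqP: w_neq0.
have s0 : s ^+ 2 = 0 by lra.
have r0 : r = 0 by lra.
have {}s0 : s = 0 by apply/eqP; rewrite -sqrf_eq0 s0.
have sum0 : \sum_i t i = 0.
  rewrite (bigD1 a') //= (bigD1 c') //= ta tc rest r0 !addr0.
  by rewrite s0 in q_ge0 sq1 sq2 *; lra.
have {sum0} t0 : forall i, t i = 0.
  move=> i; apply/eqP; move/eqP: sum0; rewrite psumr_eq0 // => /allP/(_ i).
  by rewrite mem_index_enum => /(_ isT).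
apply/rowP => k; rewrite [RHS]mxE; case: (unliftP b k) => [i|] -> //.
have [iA|/suppw //] := boolP (lift b i \in neg_coords).
by have /eqP := t0 i; rewrite tA // s0 addr0 sqrf_eq0 => /eqP.
Qed.

(** On the complementary coordinates s = u_a = 0, so the form reduces to -4 sum tau u^2 + u_c^2/2,
    where tau is nonpositive wherever u may be nonzero. *)
Lemma neg_coords_ge : (2 < deg e c)%N -> (neg_inertia Delta <= #|neg_coords|)%N.
Proof.
move=> deg_c3; have [P defP] := twin_map_mx.
suff: (neg_inertia Delta + #|~: neg_coords| <= m.+1)%N.
  have := cardsC neg_coords; rewrite card_ord => eqm.
  by rewrite -[X in (_ <= X)%N]eqm leq_add2r.
apply: (neg_inertia_le (P := P) dist_sq_mx_sym) => w suppw; rewrite defP.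
have w0 x : x \in neg_coords -> w 0 x = 0 by move=> xA; apply: suppw; rewrite inE negbK.
have wa : w 0 a = 0 by apply: w0; rewrite !inE eqxx orbT.
have wb : w 0 b = 0 by apply: w0; rewrite !inE eqxx !orbT.
split; last exact: twin_map_inj.
rewrite qform_twin_map wa wb.
have sum_le0 : \sum_i (tau R E i * w 0 (lift b i) ^+ 2 + 2 * 0 * w 0 (lift b i) + 0 ^+ 2) <= 0.
  apply: sumr_le0 => i _; rewrite mulr0 mul0r expr0n !addr0.
  have [iA|iA] := boolP (lift b i \in neg_coords); first by rewrite w0 // expr0n mulr0.
  by rewrite mulr_le0_ge0 ?sqr_ge0 // tau_nonneg.
by have := sqr_ge0 (0 - w 0 c + 0); lra.
Qed.

Lemma neg_inertia_dist_le : (neg_inertia Delta <= m)%N.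
Proof.
rewrite -ltnS -[X in (X < _)%N]addn0 -addnS -(cards1 b).
(* This [P] sends the single coordinate b to multiples of the all-ones vector, where the form is
   nonnegative because all entries of the matrix are. *)
apply: (neg_inertia_le (P := const_mx 1) dist_sq_mx_sym) => w suppw.
have wP k : (w *m const_mx 1) 0 k = w 0 b.
  rewrite mxE (bigD1 b) //= mxE mulr1 big1 ?addr0 // => i ib.
  by rewrite suppw ?mul0r // inE.
split.
  rewrite qform_dist_sq_mx; apply: sumr_ge0 => i _; apply: sumr_ge0 => j _.
  by rewrite !wP mulr_ge0 ?sqr_ge0 // -expr2 sqr_ge0.
move/rowP/(_ b); rewrite wP mxE => wb; apply/rowP => k; rewrite [RHS]mxE.
by have [->//|kb] := eqVneq k b; rewrite suppw // inE.
Qed.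

(** The triangle is then closed under adjacency, hence it is the whole connected graph. *)
Lemma deg_c_le2 : (deg e c <= 2)%N -> (m <= 2)%N.
Proof.
move=> deg_c2.
have nbr_c x : e c x = (x \in [set a; b]).
  have sub : [set a; b] \subset [set y | e c y].
    by apply/subsetP => y; rewrite !inE => /orP[]/eqP->; rewrite esym ?eac ?ebc.
  have /eqP-> : [set a; b] == [set y | e c y].
    by rewrite eqEcard sub cards2 neq_ab.
  by rewrite inE.
have cl : closed e [set a; b; c].
  apply: intro_closed; first exact: sym_connect_sym.
  move=> x y + ; rewrite !inE => exy /orP[/orP[]|] /eqP eqx; move: exy; rewrite eqx.
  - by rewrite nbr_a => /orP[]/eqP->; rewrite eqxx ?orbT.
  - by rewrite nbr_b => /orP[]/eqP->; rewrite eqxx ?orbT.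
  - by rewrite nbr_c !inE => ->.
have all_in x : x \in [set a; b; c].
  by rewrite -(closed_connect cl (econ a x)) !inE eqxx.
have : (#|'I_m.+1| <= #|[set a; b; c]|)%N by apply/subset_leq_card/subsetP.
rewrite card_ord => le; have := leq_trans le (leq_card_setU _ _).
by rewrite cards1 cards2 neq_ab.
Qed.

Lemma neg_inertia_triangle : neg_inertia Delta = (nleaves e + 2)%N.
Proof.
rewrite -card_neg_coords; apply/eqP; rewrite eqn_leq neg_coords_le andbT.
have [deg_c3|/deg_c_le2 m2] := ltnP 2 (deg e c); first exact: neg_coords_ge.
apply: leq_trans neg_inertia_dist_le (leq_trans m2 _).
by rewrite card_neg_coords leq_addl.
Qed.
End Triangle.

(** * Labelling the vertices of the triangle *)

Lemma nbr_of_deg_le2 n (e : rel 'I_n) x y z : e x y -> e x z -> y != z ->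
  deg e x <= 2 -> forall w, e x w = (w == y) || (w == z).
Proof.
move=> exy exz neq_yz deg2 w.
have sub : [set y; z] \subset [set v | e x v].
  by apply/subsetP => v; rewrite !inE => /orP[]/eqP->.
have /setP/(_ w) : [set y; z] = [set v | e x v].
  by apply/eqP; rewrite eqEcard sub cards2 neq_yz.
by rewrite !inE => ->.
Qed.

Theorem theorem7p2 (R : rcfType) (n : nat) (e : rel 'I_n) :
  (2 < n)%N ->
  simple_graph e ->
  connected_graph e ->
  (* exactly one cycle, and it has 3 vertices: *)
  (exists C : {set 'I_n},
      #|C| = 3%N /\
      (exists s, is_cycle e s) /\
      (forall s, is_cycle e s -> [set x in s] = C) /\
      (* at most one vertex of the triangle has degree > 2 *)
      (#|[set x in C | (2 < deg e x)%N]| <= 1)%N) ->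
  neg_inertia (dist_sq_mx R e) = (nleaves e + 2)%N.
Proof.
case: n e => [//|m] e _ [esym eirr] econ [C [cardC [[s cyc_s] [cyc degC]]]].
have key a b c : e a b -> e b c -> e c a -> C = [set a; b; c] ->
    deg e a <= 2 -> deg e b <= 2 -> neg_inertia (dist_sq_mx R e) = (nleaves e + 2)%N.
  move=> eab ebc eca defC deg_a deg_b.
  have neq u v : e u v -> u != v by apply: contraTneq => ->; rewrite eirr.
  have eac : e a c by rewrite esym.
  have eba : e b a by rewrite esym.
  case: (unliftP b a) => [a' def_a|eq_ab]; last by have := neq _ _ eab; rewrite eq_ab eqxx.
  case: (unliftP b c) => [c' def_c|eq_cb]; last by have := neq _ _ ebc; rewrite eq_cb eqxx.
  apply: (neg_inertia_triangle esym eirr econ eab _ _ _ R def_a def_c).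
  - exact: nbr_of_deg_le2 eab eac (neq _ _ ebc) deg_a.
  - exact: nbr_of_deg_le2 eba ebc (neq _ _ eac) deg_b.
  - by rewrite -defC.
have defC := cyc s cyc_s; move: cyc_s; rewrite /is_cycle => /andP[/andP[_ uniq_s] cycle_s].
have : size s = 3 by move/card_uniqP: uniq_s => <-; rewrite -cardC -defC cardsE.
case: s defC uniq_s cycle_s => [|x [|y [|z []]]] //= defC uniq_s /and4P[exy eyz ezx _] _.
have {}defC : C = [set x; y; z] by rewrite -defC; apply/setP => w; rewrite !inE orbA.
have one u v : u \in C -> v \in C -> u != v -> 2 < deg e u -> deg e v <= 2.
  move=> uC vC neq_uv deg_u; rewrite leqNgt; apply/negP => deg_v.
  have : [set u; v] \subset [set x in C | 2 < deg e x].
    by apply/subsetP => w; rewrite !inE => /orP[]/eqP->; apply/andP.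
  by move/subset_leq_card; rewrite cards2 neq_uv => /leq_trans/(_ degC).
have [xC yC zC] : [/\ x \in C, y \in C & z \in C] by rewrite defC !inE !eqxx !orbT.
move: uniq_s; rewrite !inE negb_or andbT => /andP[/andP[xy xz] yz].
(* The cycle is rotated so that a vertex of degree above 2, if there is one, takes the role of c. *)
have [deg_x|deg_x] := leqP (deg e x) 2; last first.
  apply: (key y z x) => //; [| exact: one deg_x | exact: one deg_x].
  by rewrite defC; apply/setP => w; rewrite !inE [RHS]orbC orbA.
have [deg_y|deg_y] := leqP (deg e y) 2; first exact: (key x y z).
apply: (key z x y) => //; last by apply: one deg_y.
by rewrite defC; apply/setP => w; rewrite !inE -[RHS]orbA [RHS]orbC.
Qed.
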